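(* Let $A,B_0,\dots,B_n\subseteq\omega$ be infinite sets such that $A\le^{ui}_e B_i$ for each $i\le n$. Then $A\le^i_e \bigcup_{i=0}^n B_i$.
   Context: An enumeration operator $\Theta$ is a c.e. set of pairs $\langle u,n\rangle$, with $\Theta(X)=\{n:\exists u\,(D_u\subseteq X\wedge\langle u,n\rangle\in\Theta)\}$ ($D_u$ the finite set of canonical index $u$); $A\le_e X$ if $A=\Theta(X)$ for some enumeration operator. For infinite sets $A,B$: $A\le^{ui}_e B$ means there is a single enumeration operator $\Theta$ with $\Theta(C)=A$ for every infinite $C\subseteq B$; $A\le^i_e B$ means $A\le_e C$ for every infinite $C\subseteq B$. *)

(* Defs.v *)
From Stdlib Require Cantor.
From mathcomp Require Import all_boot.
From mathcomp Require Import all_classical.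

Set Implicit Arguments.
Unset Strict Implicit.
Unset Printing Implicit Defensive.

Local Open Scope classical_set_scope.

(* Kleene's scheme: programs for the n-ary partial recursive functions. *)
Inductive murec : nat -> Type :=
| Zero n : murec n
| Succ : murec 1
| Proj n (i : 'I_n) : murec n
| Comp m n (f : murec m) (g : 'I_m -> murec n) : murec n
| Prec n (f : murec n) (g : murec n.+2) : murec n.+1
| Mu n (f : murec n.+1) : murec n.

Fixpoint prec_graph (F : nat -> Prop) (G : nat -> nat -> nat -> Prop)
    (k y : nat) : Prop :=
  match k with
  | 0 => F y
  | k'.+1 => exists z, prec_graph F G k' z /\ G k' z y
  end.

(* Graph of the partial function computed by a program: [eval f v y] means that
   f(v) converges with value y.
   [Prec f g] is h(0, x) = f(x), h(k+1, x) = g(k, h(k, x), x).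
   [Mu f] is the least y with f(y, x) = 0; as usual f(z, x) must converge for
   every z < y. *)
Fixpoint eval n (f : murec n) : n.-tuple nat -> nat -> Prop :=
  match f in murec n return n.-tuple nat -> nat -> Prop with
  | Zero _ => fun _ y => y = 0
  | Succ => fun v y => y = (thead v).+1
  | Proj _ i => fun v y => y = tnth v i
  | Comp m _ f g => fun v y =>
      exists w : m.-tuple nat, (forall i, eval (g i) v (tnth w i)) /\ eval f w y
  | Prec _ f g => fun v y =>
      let x := behead_tuple v in
      prec_graph (eval f x) (fun k z => eval g (cons_tuple k (cons_tuple z x)))
        (thead v) y
  | Mu _ f => fun v y =>
      eval f (cons_tuple y v) 0 /\
      forall z, z < y -> exists t, eval f (cons_tuple z v) t.+1
  end.

Definition ce (W : set nat) : Prop :=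
  exists f : murec 1, forall x, W x <-> exists y, eval f [tuple x] y.

(* The finite set D_u of canonical index u, i.e. u is the sum of the 2 ^ x for
   x in D_u. *)
Definition canon (u : nat) : set nat := [set x | odd (u %/ 2 ^ x)].

Definition pair_code (u n : nat) : nat := Cantor.to_nat (u, n).

Definition enum_apply (Theta X : set nat) : set nat :=
  [set n | exists u, canon u `<=` X /\ Theta (pair_code u n)].

Definition e_le (A X : set nat) : Prop :=
  exists Theta, ce Theta /\ A = enum_apply Theta X.

Definition ui_e_le (A B : set nat) : Prop :=
  exists Theta, ce Theta /\
    forall C, infinite_set C -> C `<=` B -> enum_apply Theta C = A.

Definition i_e_le (A B : set nat) : Prop :=
  forall C, infinite_set C -> C `<=` B -> e_le A C.

(* Main.v *)
(* The proof is by induction on the number of the sets B_i. Let C be an infinite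
   subset of their union with A not e-reducible to C, let Theta_i witness the
   uniform reduction of A to B_i, and colour the elements of C with the indices i;
   X_i is the set of elements of C of colour i.

   Call a finite colouring bad for a if a is in Theta_i(X_i) for some i. Colouring
   each x by an i with x in B_i shows that if all colourings of some finite part of
   C are bad for a, then a is in A. These a are enumerated from C, so they are not
   all of A, and some a in A has, by compactness, a nonempty class of total
   colourings that are not bad for it. This class is Pi^0_1 relative to
   enumerations of C. Forcing with such classes gives a colouring X in it with A
   not e-reducible to X_i, for all i: for an operator Psi, either the class can be
   shrunk to one on which Psi(X_i) differs from A, or A is the set of m that are in
   Psi(X_i) for all X in the class, which by compactness is e-reducible to C.

   Since a is not in Theta_i(X_i), every X_i meets B_i in a finite set. Some X_i is
   infinite, and up to a finite set it is covered by the other B_j, so that the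
   induction hypothesis gives an e-reduction of A to X_i, a contradiction. *)

From Stdlib Require Cantor Eqdep_dec PeanoNat.
From mathcomp Require Import all_boot.
From mathcomp Require Import zify.
From mathcomp Require Import all_classical.
(* Loaded last because [all_classical] also exports a constant named [canon]. *)
Require Import Defs.

Set Implicit Arguments.
Unset Strict Implicit.
Unset Printing Implicit Defensive.

Local Open Scope classical_set_scope.

(** * Total recursive functions *)

(* The lists play the role of contexts: a quantifier or a primitive recursion
   pushes its bound variable in front, and variable i is the head of the i-th
   iterated tail. Values on lists of length other than n are irrelevant. *)
Definition rec n (F : seq nat -> nat) : Prop :=
  exists p : murec n, forall (v : n.-tuple nat) y, eval p v y <-> y = F v.

Definition dec n (D : seq nat -> bool) : Prop := rec n (fun v => D v).

Lemma rec_ext n F G : (forall v, size v = n -> F v = G v) -> rec n F -> rec n G.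
Proof.
move=> FG [p pF]; exists p => v y.
by rewrite pF FG // size_tuple.
Qed.

Lemma rec_nth n i : i < n -> rec n (fun v => nth 0 v i).
Proof.
move=> lin; exists (Proj (Ordinal lin)) => v y /=.
by rewrite (tnth_nth 0).
Qed.

Lemma rec_zero n : rec n (fun=> 0).
Proof. by exists (Zero n). Qed.

Lemma rec_comp n F (Gs : seq (seq nat -> nat)) :
  rec (size Gs) F ->
  (forall i, i < size Gs -> rec n (nth (fun=> 0) Gs i)) ->
  rec n (fun v => F [seq G v | G <- Gs]).
Proof.
move=> [p pF] HG.
have /choice[q qG] : forall i : 'I_(size Gs), exists q : murec n,
    forall (v : n.-tuple nat) y, eval q v y <-> y = nth (fun=> 0) Gs i v.
  by move=> i; exact: HG.
exists (Comp p q) => v y /=; split.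
  move=> [w [qw /pF ->]]; congr F.
  apply: (@eq_from_nth _ 0); rewrite size_tuple ?size_map // => i lti.
  have /qG := qw (Ordinal lti).
  by rewrite (tnth_nth 0) /= => ->; rewrite (nth_map (fun=> 0)).
move=> ->; exists (map_tuple (fun G : seq nat -> nat => G v) (in_tuple Gs)); split; last exact/pF.
by move=> i; apply/qG; rewrite (tnth_nth 0) /= (nth_map (fun=> 0)).
Qed.

Lemma rec_comp1 n F G : rec 1 F -> rec n G -> rec n (fun v => F [:: G v]).
Proof.
by move=> rF rG; apply: (rec_comp (Gs := [:: G])) => // -[].
Qed.

Lemma rec_comp2 n F G1 G2 :
  rec 2 F -> rec n G1 -> rec n G2 -> rec n (fun v => F [:: G1 v; G2 v]).
Proof.
by move=> rF rG rG2; apply: (rec_comp (Gs := [:: G1; G2])) => // -[|[]].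
Qed.

Lemma rec_succ n F : rec n F -> rec n (fun v => (F v).+1).
Proof.
apply: (rec_comp1 (F := fun v => (head 0 v).+1)).
by exists Succ => v y; rewrite /= (tuple_eta v).
Qed.

Lemma rec_cst n c : rec n (fun=> c).
Proof. by elim: c => [|c]; [exact: rec_zero | exact: rec_succ]. Qed.

Lemma rec_head n : rec n.+1 (head 0).
Proof.
by apply: rec_ext (rec_nth (ltn0Sn n)) => v _; rewrite nth0.
Qed.

Lemma rec_behead n F : rec n F -> rec n.+1 (fun v => F (behead v)).
Proof.
move=> rF.
have := @rec_comp n.+1 F [seq (fun v => nth 0 v i) | i <- iota 1 n].
rewrite size_map size_iota => /(_ rF) H.
apply: rec_ext (H _) => [v sv|i lin].
  congr F; apply: (@eq_from_nth _ 0); rewrite !size_map size_iota ?size_behead ?sv //.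
  move=> i lin; rewrite (nth_map (fun=> 0)) ?size_map ?size_iota //.
  by rewrite (nth_map 0) ?size_iota // nth_iota // nth_behead.
by rewrite (nth_map 0) ?size_iota // nth_iota //; apply: rec_nth.
Qed.

Lemma rec_subst_head n F K :
  rec n.+1 F -> rec n K -> rec n (fun v => F (K v :: v)).
Proof.
move=> rF rK.
have := @rec_comp n F (K :: [seq (fun v => nth 0 v i) | i <- iota 0 n]).
rewrite /= size_map size_iota => /(_ rF) H.
apply: rec_ext (H _) => [v sv|[//|i] lin].
  by rewrite /= -map_comp /=; congr (F (_ :: _)); rewrite -sv map_nth_iota0 // take_size.
by rewrite /= (nth_map 0) ?size_iota // nth_iota //; apply: rec_nth.
Qed.

(** [Prec] recurses on the head variable only, so the bound [K] is substituted for it afterwards. *)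
Lemma rec_nat_rec n F K (G : nat -> nat -> seq nat -> nat) :
  rec n F ->
  rec n.+2 (fun v => G (head 0 v) (head 0 (behead v)) (behead (behead v))) ->
  rec n K ->
  rec n (fun v => nat_rec _ (F v) (fun k z => G k z v) (K v)).
Proof.
move=> [p pF] [q qG] rK.
apply: (rec_subst_head (F := fun v => nat_rec _ (F (behead v))
   (fun k z => G k z (behead v)) (head 0 v))) rK.
exists (Prec p q) => v y /=.
rewrite -[head 0 v]/(nth 0 v 0) -[behead v]/(tval (behead_tuple v)).
have -> : nth 0 v 0 = thead v by rewrite /thead (tnth_nth 0).
move: (thead v) (behead_tuple v) y => k x; elim: k => [|k IH] y /=; first exact: pF.
split=> [[z [/IH -> /qG //]]|->].
by eexists; split; [exact/IH | exact/qG].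
Qed.

(** A truth value is a number, so a case distinction is a primitive recursion of length 0 or 1. *)
Lemma rec_if n D F G :
  dec n D -> rec n F -> rec n G -> rec n (fun v => if D v then F v else G v).
Proof.
move=> dD rF rG.
apply: rec_ext (rec_nat_rec (G := fun _ _ => F) rG _ dD) => [v _|]; first by case: (D v).
exact: rec_behead (rec_behead rF).
Qed.

Lemma rec_pred n F : rec n F -> rec n (fun v => (F v).-1).
Proof.
move=> rF.
apply: rec_ext (rec_nat_rec (G := fun k _ _ => k) (rec_zero n) _ rF) => [v _|].
  by case: (F v).
exact: rec_head.
Qed.

Lemma rec_add n F G : rec n F -> rec n G -> rec n (fun v => F v + G v).
Proof.
move=> rF rG.
apply: rec_ext (rec_nat_rec (G := fun _ z _ => z.+1) rF _ rG) => [v _|].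
  by elim: (G v) => [|k /= ->]; rewrite ?addn0 ?addnS.
exact: rec_succ (rec_behead (rec_head n)).
Qed.

Lemma rec_sub n F G : rec n F -> rec n G -> rec n (fun v => F v - G v).
Proof.
move=> rF rG.
apply: rec_ext (rec_nat_rec (G := fun _ z _ => z.-1) rF _ rG) => [v _|].
  by elim: (G v) => [|k /= ->]; rewrite ?subn0 ?subnS.
exact: rec_pred (rec_behead (rec_head n)).
Qed.

Lemma dec_eq0 n F : rec n F -> dec n (fun v => F v == 0).
Proof.
move=> rF; apply: rec_ext (rec_sub (rec_cst n 1) rF) => v _.
by case: (F v) => [|[]].
Qed.

Lemma dec_neg n D : dec n D -> dec n (fun v => ~~ D v).
Proof. by move/dec_eq0; apply: rec_ext => v _; case: (D v). Qed.

Lemma dec_and n D E : dec n D -> dec n E -> dec n (fun v => D v && E v).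
Proof.
move=> dD dE; apply: rec_ext (rec_if dD dE (rec_zero n)) => v _.
by case: (D v).
Qed.

Lemma dec_leq n F G : rec n F -> rec n G -> dec n (fun v => F v <= G v).
Proof. by move=> rF rG; exact/dec_eq0/rec_sub. Qed.

Lemma dec_ltn n F G : rec n F -> rec n G -> dec n (fun v => F v < G v).
Proof. by move=> rF rG; exact: dec_leq (rec_succ rF) rG. Qed.

Lemma dec_eqn n F G : rec n F -> rec n G -> dec n (fun v => F v == G v).
Proof.
move=> rF rG; apply: rec_ext (dec_and (dec_leq rF rG) (dec_leq rG rF)) => v _.
by rewrite -eqn_leq.
Qed.

Lemma rec_sum n K (F : nat -> seq nat -> nat) :
  rec n K -> rec n.+1 (fun v => F (head 0 v) (behead v)) ->
  rec n (fun v => \sum_(i < K v) F i v).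
Proof.
move=> rK rF.
apply: rec_ext (rec_nat_rec (G := fun k z v => z + F k v) (rec_zero n) _ rK) => [v _|].
  by elim: (K v) => [|k /= ->]; rewrite ?big_ord0 // big_ord_recr.
apply: rec_add; first exact: rec_behead (rec_head n).
have := @rec_comp n.+2 _ (head 0 ::
   [seq (fun v => nth 0 v i) | i <- iota 2 n]).
rewrite /= size_map size_iota => /(_ _ rF) H.
apply: rec_ext (H _) => [v sv|[|i] lin]; last 2 first.
- exact: rec_head.
- rewrite /= (nth_map 0) ?size_iota // nth_iota //; exact: rec_nth.
congr F; apply: (@eq_from_nth _ 0); rewrite !size_map size_iota ?size_behead ?sv //.
move=> i lin; rewrite (nth_map (fun=> 0)) ?size_map ?size_iota //.
by rewrite (nth_map 0) ?size_iota // nth_iota // !nth_behead.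
Qed.

Lemma dec_all n K (D : nat -> seq nat -> bool) :
  rec n K -> dec n.+1 (fun v => D (head 0 v) (behead v)) ->
  dec n (fun v => all (fun i => D i v) (iota 0 (K v))).
Proof.
move=> rK /dec_neg dD.
apply: rec_ext (dec_eq0 (rec_sum (F := fun i v => ~~ D i v) rK dD)) => v _; congr nat_of_bool.
rewrite sum_nat_eq0; apply/forallP/allP => [H i|H i].
  rewrite mem_iota /= add0n => lti; have := H (Ordinal lti).
  by rewrite /=; case: (D i v).
by rewrite /= H // mem_iota /= add0n.
Qed.

Lemma dec_has n K (D : nat -> seq nat -> bool) :
  rec n K -> dec n.+1 (fun v => D (head 0 v) (behead v)) ->
  dec n (fun v => has (fun i => D i v) (iota 0 (K v))).
Proof.
move=> rK /dec_neg dD.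
apply: rec_ext (dec_neg (dec_all (D := fun i v => ~~ D i v) rK dD)) => v _.
by rewrite -has_predC; congr nat_of_bool; apply: eq_has => i /=; rewrite negbK.
Qed.

Lemma rec_mul n F G : rec n F -> rec n G -> rec n (fun v => F v * G v).
Proof.
move=> rF rG.
apply: rec_ext (rec_sum (F := fun _ => F) rG (rec_behead rF)) => v _.
by rewrite sum_nat_const card_ord mulnC.
Qed.

Lemma rec_exp n F G : rec n F -> rec n G -> rec n (fun v => F v ^ G v).
Proof.
move=> rF rG.
apply: rec_ext (rec_nat_rec (G := fun _ z v => F v * z) (rec_cst n 1) _ rG) => [v _|].
  by elim: (G v) => [|k /= ->]; rewrite ?expn0 ?expnS.
apply: rec_mul; first exact: rec_behead (rec_behead rF).
exact: rec_behead (rec_head n).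
Qed.

(** The quotient counts the positive multiples of [d] up to [m]; the guard [0 < d] gives the value 0
    for division by zero. *)
Lemma divn_sum m d : m %/ d = \sum_(i < m) ((0 < d) && (i.+1 * d <= m)).
Proof.
case: d => [|d]; first by rewrite divn0 big1.
under eq_bigr => i _ do rewrite /= -leq_divRL //.
rewrite -(big_mkord xpredT (fun i => nat_of_bool (i.+1 <= m %/ d.+1))).
have le := leq_div m d.+1.
rewrite (big_cat_nat (leq0n _) le) /= [X in _ + X]big_nat_cond [X in _ + X]big1 => [|i]; last first.
  by rewrite andbT => /andP[lei _]; rewrite ltnNge lei.
rewrite big_nat_cond (eq_bigr (fun=> 1)) => [|i /andP[/andP[_ ->]]//].
by rewrite -big_nat_cond sum_nat_const_nat subn0 addn0 muln1.
Qed.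

Lemma rec_div n F G : rec n F -> rec n G -> rec n (fun v => F v %/ G v).
Proof.
move=> rF rG.
apply: (rec_ext (F := fun v => \sum_(i < F v) ((0 < G v) && (i.+1 * G v <= F v)))).
  by move=> v _; rewrite divn_sum.
apply: (rec_sum (F := fun i v => (0 < G v) && (i.+1 * G v <= F v))) => //.
have rF' := rec_behead rF; have rG' := rec_behead rG.
exact: (dec_and (dec_ltn (rec_zero _) rG')
  (dec_leq (rec_mul (rec_succ (rec_head n)) rG') rF')).
Qed.

Lemma rec_mod n F G : rec n F -> rec n G -> rec n (fun v => F v %% G v).
Proof.
move=> rF rG; apply: rec_ext (rec_sub rF (rec_mul (rec_div rF rG) rG)) => v _.
by rewrite {1}(divn_eq (F v) (G v)) addKn.
Qed.

Definition canonb (u x : nat) : bool := odd (u %/ 2 ^ x).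

Lemma canonE u x : canon u x = canonb u x.
Proof. by []. Qed.

Lemma dec_canon n F G : rec n F -> rec n G -> dec n (fun v => canonb (F v) (G v)).
Proof.
move=> rF rG.
apply: rec_ext (rec_mod (rec_div rF (rec_exp (rec_cst n 2) rG)) (rec_cst n 2)) => v _.
by rewrite modn2.
Qed.

Lemma rec_pair_code n F G :
  rec n F -> rec n G -> rec n (fun v => pair_code (F v) (G v)).
Proof.
move=> rF rG.
(* This is the recursion inside [Cantor.to_nat]: the triangular number of [G v + F v], to which
   [G v] is added. *)
have H := rec_nat_rec (G := fun i m _ => i.+1 + m) (rec_zero n) _ (rec_add rG rF).
apply: rec_ext (rec_add rG (H _)) => [v _|].
  by rewrite /pair_code.
apply: rec_add; first exact: rec_succ (rec_head _).
exact: rec_behead (rec_head n).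
Qed.

Lemma dec_forall_ord n m (D : 'I_m -> seq nat -> bool) :
  (forall i, dec n (D i)) -> dec n (fun v => [forall i, D i v]).
Proof.
move=> dD.
apply: (rec_ext (F := fun v => all (fun i => D i v) (enum 'I_m))) => [v _|].
  congr nat_of_bool; apply/allP/forallP => [H i|H i _]; last exact: H.
  by apply: H; rewrite mem_enum.
elim: (enum 'I_m) => [|i s IH]; first exact: rec_cst.
exact: (dec_and (dD i) IH).
Qed.

Lemma dec_exists_ord n m (D : 'I_m -> seq nat -> bool) :
  (forall i, dec n (D i)) -> dec n (fun v => [exists i, D i v]).
Proof.
move=> dD; apply: rec_ext (dec_neg (dec_forall_ord (fun i => dec_neg (dD i)))) => v _.
by congr nat_of_bool; rewrite negb_forall; apply: eq_existsb => i; rewrite negbK.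
Qed.

(** * Stagewise evaluation of programs *)

Lemma head_tuple n (v : n.+1.-tuple nat) : head 0 v = thead v.
Proof. by rewrite (tuple_eta v). Qed.

Lemma eventually_ord m (P : 'I_m -> nat -> Prop) :
  (forall i, exists s0, forall s, s0 <= s -> P i s) ->
  exists s0, forall s, s0 <= s -> forall i, P i s.
Proof.
move=> /choice[S PS]; exists (\max_i S i) => s les i.
by apply: PS; apply: leq_trans les; apply: leq_bigmax.
Qed.

(* F (s :: v) is y.+1 if the computation of p on v has been seen to converge to y
   by stage s, and 0 otherwise. Carrying the value rather than a decidable graph
   makes primitive recursion go through without any coding of sequences. *)
Definition stage n (p : murec n) (F : seq nat -> nat) : Prop :=
  [/\ rec n.+1 F,
      forall s (v : n.-tuple nat) y, F (s :: v) = y.+1 -> eval p v y &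
      forall (v : n.-tuple nat) y, eval p v y ->
        exists s0, forall s, s0 <= s -> F (s :: v) = y.+1].

Lemma stage_total n (p : murec n) F :
  rec n F -> (forall (v : n.-tuple nat) y, eval p v y <-> y = F v) ->
  stage p (fun v => (F (behead v)).+1).
Proof.
move=> rF pF; split.
- exact: rec_succ (rec_behead rF).
- by move=> s v y [<-]; apply/pF.
- by move=> v y /pF ->; exists 0.
Qed.

Lemma stage_comp m n (p : murec m) (q : 'I_m -> murec n) F G :
  stage p F -> (forall i, stage (q i) (G i)) ->
  stage (Comp p q) (fun v => if [forall i, 0 < G i v] then
    F (head 0 v :: [seq (G i v).-1 | i <- enum 'I_m]) else 0).
Proof.
move=> [rF sF cF] sG.
have szE (H : 'I_m -> nat) : size [seq H i | i <- enum 'I_m] == m.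
  by rewrite size_map size_enum_ord.
split.
- apply: rec_if; last exact: rec_zero.
    apply: dec_forall_ord => i; case: (sG i) => rG _ _.
    exact: dec_ltn (rec_zero _) rG.
  have := @rec_comp n.+1 F (head 0 :: [seq (fun v => (G i v).-1) | i <- enum 'I_m]).
  rewrite /= size_map size_enum_ord => /(_ rF) H.
  apply: rec_ext (H _) => [v _|[|i] lim]; first by rewrite -map_comp.
    exact: rec_head.
  pose k : 'I_m := Ordinal (lim : i < m).
  rewrite /= (nth_map k) ?size_enum_ord //.
  by apply: rec_pred; case: (sG (nth k (enum 'I_m) i)).
- move=> s v y; case: forallP => // G0 Fy.
  exists (Tuple (szE (fun i => (G i (s :: v)).-1))); split; last exact: (sF s (Tuple _) y Fy).
  move=> i; have [_ sGi _] := sG i; apply: (sGi s).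
  rewrite (tnth_nth 0) /= (nth_map i) ?size_enum_ord // nth_ord_enum.
  by rewrite prednK.
- move=> v y [w [qw pw]].
  have [s1 H1] : exists s0, forall s, s0 <= s -> forall i,
      G i (s :: v) = (tnth w i).+1.
    apply: (eventually_ord (P := fun i s => G i (s :: v) = (tnth w i).+1)) => i.
    by have [_ _ cGi] := sG i; exact: cGi (qw i).
  have [s2 H2] := cF _ _ pw.
  exists (maxn s1 s2) => s; rewrite geq_max => /andP[les1 les2].
  case: forallP => [_|[]]; last by move=> i; rewrite H1.
  rewrite -(H2 s les2) /=; congr (F (_ :: _)).
  rewrite -[RHS]map_tnth_enum; apply: eq_map => i.
  by rewrite H1.
Qed.

Lemma rec_permute n F (r : seq nat) :
  rec (size r) F -> all (fun i => i < n) r ->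
  rec n (fun v => F [seq nth 0 v i | i <- r]).
Proof.
move=> rF /allP lt.
have := @rec_comp n F [seq (fun v => nth 0 v i) | i <- r].
rewrite size_map => /(_ rF) H.
apply: rec_ext (H _) => [v _|i lti]; first by rewrite -map_comp.
by rewrite (nth_map 0) //; apply/rec_nth/lt/mem_nth.
Qed.

Lemma map_nth_iota_drop n j (v : seq nat) :
  size v = j + n -> [seq nth 0 v i | i <- iota j n] = drop j v.
Proof. by move=> sv; rewrite map_nth_iota ?sv ?addKn // take_oversize // size_drop sv addKn. Qed.

Lemma stage_prec n (p : murec n) (q : murec n.+2) F G :
  stage p F -> stage q G ->
  stage (Prec p q) (fun v => nat_rec _ (F (head 0 v :: behead (behead v)))
    (fun j z => if 0 < z then
       G (head 0 v :: j :: z.-1 :: behead (behead v)) else 0)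
    (head 0 (behead v))).
Proof.
move=> [rF sF cF] [rG sG cG]; split.
- apply: (rec_nat_rec (G := fun j z v => if 0 < z then
       G (head 0 v :: j :: z.-1 :: behead (behead v)) else 0)).
  + have /= := @rec_permute n.+2 F (0 :: iota 2 n).
    rewrite size_iota => /(_ rF) H; apply: rec_ext (H _) => [v sv|].
      by rewrite map_nth_iota_drop //; case: v sv => [|? [|? ?]] //=; rewrite drop0.
    by apply/allP => i; rewrite mem_iota => /andP[].
  + apply: rec_if; last exact: rec_zero.
      exact: dec_ltn (rec_zero _) (rec_behead (rec_head _)).
    pose v1 := (fun v : seq nat => (nth 0 v 1).-1).
    have := @rec_comp n.+4 G (nth 0 ^~ 2 :: nth 0 ^~ 0 :: v1 ::
       [seq (nth 0)^~ i | i <- iota 4 n]).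
    rewrite /= size_map size_iota => /(_ rG) H.
    apply: rec_ext (H _) => [v sv|i lin].
      rewrite -map_comp /comp map_nth_iota_drop //.
      by case: v sv => [|? [|? [|? [|? ?]]]] //=; rewrite drop0.
    case: i lin => [|[|[|i]]] lin /=; try exact: rec_nth.
      by apply: rec_pred; apply: rec_nth.
    by rewrite (nth_map 0) ?size_iota // nth_iota //; apply: rec_nth; lia.
  + exact: rec_behead (rec_head n).
- move=> s v y /=; rewrite head_tuple -[behead v]/(tval (behead_tuple v)).
  elim: (thead v) y => [|k IH] y /=; first exact: (sF s (behead_tuple v)).
  set z := nat_rec _ _ _ _ in IH *.
  case: ltnP => // z0 Gy; exists z.-1; split; first by apply: IH; rewrite prednK.
  exact: (sG s (cons_tuple k (cons_tuple z.-1 _))).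
- move=> v y /=; rewrite head_tuple -[behead v]/(tval (behead_tuple v)).
  elim: (thead v) y => [|k IH] y /=; first exact: (cF (behead_tuple v)).
  move=> [z [/IH[s1 H1] /cG[s2 H2]]].
  exists (maxn s1 s2) => s; rewrite geq_max => /andP[les1 les2].
  by rewrite H1 //=; exact: H2.
Qed.

(** At most one term of the sum is nonzero: value 1 of [F] reports the output 0 and larger values
    report positive outputs, so only the least zero passes the test. *)
Lemma stage_mu n (p : murec n.+1) F :
  stage p F ->
  stage (Mu p) (fun v => \sum_(y < head 0 v)
     ((F (head 0 v :: val y :: behead v) == 1) &&
      all (fun z => 1 < F (head 0 v :: z :: behead v)) (iota 0 y)) * y.+1).
Proof.
move=> [rF sF cF].
pose c s v y := (F (s :: y :: v) == 1) && all (fun z => 1 < F (s :: z :: v)) (iota 0 y).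
have lt_c s v y z : c s v y -> c s v z -> y <= z.
  move=> /andP[_ /allP yall] /andP[/eqP z1 _]; rewrite leqNgt; apply/negP => ltzy.
  by have := yall z; rewrite mem_iota ltzy z1 => /(_ isT).
have sumE s v y : y < s -> c s v y -> \sum_(y < s) c s v y * y.+1 = y.+1.
  move=> lts cy; rewrite (bigD1 (Ordinal lts)) //= cy mul1n big1 ?addn0 // => i.
  case cz: (c s v i) => //= /eqP[]; apply/val_inj/eqP => /=.
  by rewrite eqn_leq (lt_c _ _ _ _ cz cy) (lt_c _ _ _ _ cy cz).
have rswap : rec n.+2 (fun v => F (head 0 (behead v) :: head 0 v :: behead (behead v))).
  have /= := @rec_permute n.+2 F (1 :: 0 :: iota 2 n).
  rewrite size_iota => /(_ rF) H; apply: rec_ext (H _) => [v sv|].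
    rewrite map_nth_iota_drop //.
    by case: v sv => [|? [|? ?]] //=; rewrite drop0.
  by apply/allP => i; rewrite mem_iota => /andP[].
split.
- apply: (rec_sum (F := fun y v => c (head 0 v) (behead v) y * y.+1)); first exact: rec_head.
  apply: rec_mul; last exact: rec_succ (rec_head _).
  suff dA : dec n.+2 (fun v => all (fun z =>
      1 < F (head 0 (behead v) :: z :: behead (behead v))) (iota 0 (head 0 v))).
    exact: (dec_and (dec_eqn rswap (rec_cst _ 1)) dA).
  apply: (dec_all (D := fun z v => 1 < F (head 0 (behead v) :: z :: behead (behead v)))).
    exact: rec_head.
  suff r3 : rec n.+3 (fun v =>
      F (head 0 (behead (behead v)) :: head 0 v :: behead (behead (behead v)))).
    exact: dec_ltn (rec_cst _ 1) r3.
  have /= := @rec_permute n.+3 F (2 :: 0 :: iota 3 n).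
  rewrite size_iota => /(_ rF) H; apply: rec_ext (H _) => [v sv|].
    rewrite map_nth_iota_drop //.
    by case: v sv => [|? [|? [|? ?]]] //=; rewrite drop0.
  by apply/allP => i; rewrite mem_iota => /andP[].
- move=> s v y /= sumy.
  have [i ci] : exists i : 'I_s, c s v i.
    apply: contrapT => /forallNP nc.
    move: sumy; rewrite big1 // => i _.
    by move: (nc i) => /negP/negbTE; rewrite /c => ->.
  have := sumE s v i (ltn_ord i) ci; rewrite /c sumy => -[->].
  case/andP: ci => /eqP F1 /allP Fz; split; first exact: (sF s (cons_tuple _ _) 0 F1).
  move=> z ltz; exists (F (s :: z :: v)).-2.
  apply: (sF s (cons_tuple z v)); rewrite /=.
  by have := Fz z; rewrite mem_iota ltz => /(_ isT); case: (F _) => [|[]].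
- move=> v y [/cF[s1 H1] Hz].
  have [s2 H2] : exists s0, forall s, s0 <= s -> forall z : 'I_y, 1 < F (s :: val z :: v).
    apply: (eventually_ord (P := fun (i : 'I_y) s => 1 < F (s :: val i :: v))) => i.
    have [t /cF[s0 H]] := Hz i (ltn_ord i).
    by exists s0 => s /H /= ->.
  exists (maxn y.+1 (maxn s1 s2)) => s; rewrite !geq_max => /and3P[lty les1 les2].
  apply: (sumE s v y lty); rewrite /c H1 //=.
  apply/allP => z; rewrite mem_iota add0n => /= ltz.
  exact: (H2 s les2 (Ordinal ltz)).
Qed.

Lemma stage_exists n (p : murec n) : exists F, stage p F.
Proof.
elim: p => {n} [n||n i|m n p [F sF] q IH|n p [F sF] q [G sG]|n p [F sF]].
- by eexists; apply: (stage_total (F := fun=> 0)); first exact: rec_zero.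
- eexists; apply: (stage_total (F := fun v => (head 0 v).+1)).
    exact: rec_succ (rec_head 0).
  by move=> v y; rewrite head_tuple.
- eexists; apply: (stage_total (F := fun v => nth 0 v i)); first exact: rec_nth.
  by move=> v y /=; rewrite (tnth_nth 0).
- have /choice[G sG] := IH.
  by eexists; exact: stage_comp sF sG.
- by eexists; exact: stage_prec sF sG.
- by eexists; exact: stage_mu sF.
Qed.

(** Convergence is tested at all stages before [s] rather than at one stage, which makes the
    approximation monotone. *)
Lemma ce_stage (W : set nat) : ce W ->
  exists D, dec 2 D /\ (forall s s' x, s <= s' -> D [:: s; x] -> D [:: s'; x]) /\
    forall x, W x <-> exists s, D [:: s; x].
Proof.
move=> [p pW]; have [F [rF sF cF]] := stage_exists p.
exists (fun v => has (fun t => 0 < F (t :: behead v)) (iota 0 (head 0 v))).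
split; [|split].
- apply: (dec_has (D := fun t v => 0 < F (t :: behead v))); first exact: rec_head.
  suff r3 : rec 3 (fun v => F (head 0 v :: behead (behead v))).
    exact: dec_ltn (rec_zero _) r3.
  apply: rec_ext (@rec_permute 3 F [:: 0; 2] rF isT) => v.
  by case: v => [|? [|? [|? []]]].
- move=> s s' x les /hasP[t ts Ft]; apply/hasP; exists t => //.
  by move: ts; rewrite !mem_iota /=; lia.
- move=> x; rewrite pW; split=> [[y /cF[s Hs]]|[s /hasP[t _]]].
    exists s.+1; apply/hasP; exists s; first by rewrite mem_iota /= add0n.
    by have /= -> := Hs s (leqnn s).
  case Fy: (F _) => [//|y] _; exists y; exact: (sF t).
Qed.

Lemma ce_of_dec (D : seq nat -> bool) :
  dec 2 D -> ce [set x | exists s, D [:: s; x]].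
Proof.
move=> /dec_neg[p pD]; exists (Mu p) => x; split=> [[s Ds]|[y [/pD Dy _]]]; last first.
  by exists y; move: Dy; rewrite /=; case: (D _).
exists (ex_minn (ex_intro (fun s => D [:: s; x]) s Ds)).
case: ex_minnP => m Dm minm; split; first by apply/pD; rewrite /= Dm.
move=> z ltz; exists 0; apply/pD; rewrite /=.
by case Dz: (D _) => //; have := minm z Dz; lia.
Qed.

(** * Coding of programs and a listing of the c.e. sets *)

Fixpoint code n (p : murec n) : GenTree.tree nat :=
  match p with
  | Zero n => GenTree.Node 0 [:: GenTree.Leaf n]
  | Succ => GenTree.Node 1 [::]
  | Proj n i => GenTree.Node 2 [:: GenTree.Leaf n; GenTree.Leaf (val i)]
  | Comp m n f g => GenTree.Node 3 [:: GenTree.Leaf m, GenTree.Leaf n, code f &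
                      [seq code (g i) | i <- enum 'I_m]]
  | Prec n f g => GenTree.Node 4 [:: code f; code g]
  | Mu n f => GenTree.Node 5 [:: code f]
  end.

Lemma existT_murec_inj n (p q : murec n) :
  existT murec n p = existT murec n q -> p = q.
Proof. exact: (Eqdep_dec.inj_pair2_eq_dec _ PeanoNat.Nat.eq_dec). Qed.

(** Equal codes first identify the arities, read off leaves or obtained from the induction
    hypothesis; only then do the subprograms share a type and can be compared. *)
Lemma code_inj n (p : murec n) n' (p' : murec n') :
  code p = code p' -> existT murec n p = existT murec n' p'.
Proof.
elim: p n' p' => {n} [n||n i|m n f IHf g IHg|n f IHf g IHg|n f IHf] n'.
- by case=> //= k [->].
- by case.
- case=> //= k j [nk]; case: _ / nk j => j [ij].
  by congr (existT _ _ (Proj _)); apply: val_inj.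
- case=> //= m' k f' g' [mm' nk]; case: _ / nk g' => g'.
  case: _ / mm' f' g' => f' g' /IHf/existT_murec_inj <- eg.
  suff -> : g = g' by [].
  apply/funext => i; apply/existT_murec_inj/IHg.
  by have /eq_in_map := eg; apply; rewrite mem_enum.
- case=> //= k f' g' [/IHf ef].
  have nk : n = k by exact: (congr1 (@projT1 _ _) ef).
  case: _ / nk f' g' ef => f' g' /existT_murec_inj <- /IHg/existT_murec_inj <- //.
- case=> //= k f' [/IHf ef].
  have nk : n.+1 = k.+1 by exact: (congr1 (@projT1 _ _) ef).
  case: nk => nk; case: _ / nk f' ef => f' /existT_murec_inj <- //.
Qed.

(** This lists the operators to diagonalise against. The listing is chosen classically, with
    [Zero 1] as default at numbers that code no unary program; no effectiveness is claimed. *)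
Lemma ce_enumeration : exists W : nat -> set nat,
  (forall e, ce (W e)) /\ forall V, ce V -> exists e, W e = V.
Proof.
have /choice[p pE] : forall e, exists p : murec 1,
    forall q : murec 1, pickle (code q) = e -> p = q.
  move=> e; have [[q <-]|H] := pselect (exists q : murec 1, pickle (code q) = e).
    exists q => q' /(pcan_inj pickleK)/code_inj eq'.
    exact/esym/existT_murec_inj.
  by exists (Zero 1) => q qe; case: H; exists q.
exists (fun e => [set x | exists y, eval (p e) [tuple x] y]); split.
  by move=> e; exists (p e).
move=> V [q qV]; exists (pickle (code q)); apply/seteqP.
by split=> x /=; rewrite (pE _ q) // qV.
Qed.

(** * Relations enumerated from a set *)

(** Base 2 yields canonical indices of finite sets, base [k.+1] codes of finite colourings. The
    induction shifts [X] and appends [X 0] as the lowest digit. *)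
Lemma digits_exist k (X : nat -> nat) l : (forall x, X x < k) ->
  exists2 p, p < k ^ l &
    forall x, (p %/ k ^ x) %% k = if x < l then X x else 0.
Proof.
elim: l X => [|l IH] X Xk.
  by exists 0; rewrite ?expn0 // => x; rewrite div0n mod0n.
have [p ltp pX] := IH (X \o succn) (fun x => Xk x.+1).
have k0 : 0 < k by apply: leq_trans (Xk 0).
exists (p * k + X 0).
  rewrite expnSr; apply: (@leq_trans (p.+1 * k)); last by rewrite leq_mul2r ltp orbT.
  by rewrite mulSn addnC ltn_add2r.
case=> [|x]; first by rewrite expn0 divn1 modnMDl modn_small.
by rewrite expnS divnMA divnMDl // (divn_small (Xk 0)) addn0 pX.
Qed.

Lemma canon_index (b : pred nat) l :
  exists u, forall x, canonb u x = (x < l) && b x.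
Proof.
have [|u _ uX] := @digits_exist 2 (fun x => b x) l; first by move=> x; case: (b x).
exists u => x; have := uX x; rewrite /canonb modn2.
by case: odd; case: (x < l); case: (b x).
Qed.

(** A bit at position [x] forces [2 ^ x <= u]. Quantifiers over a finite set are thereby bounded by
    its index. *)
Lemma canonb_lt u x : canonb u x -> x < u.
Proof.
rewrite ltnNge; apply: contraL => leux.
by rewrite /canonb divn_small // (leq_ltn_trans leux) // ltn_expl.
Qed.

Lemma canon_setU u u' : exists w, canon w = canon u `|` canon u'.
Proof.
have [w wE] := canon_index (fun x => canonb u x || canonb u' x) (maxn u u').
exists w; apply/seteqP; split => x; rewrite /setU /= !canonE wE.
  by move=> /andP[_ /orP].
move=> /orP h; rewrite h andbT leq_max.
by case/orP: h => /canonb_lt ->; rewrite ?orbT.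
Qed.

(* The relations of arity n e-reducible to C. Monotonicity of the matrix in the
   stage s and in the finite set D_u used is what allows conjunctions and bounded
   quantifiers to take a common stage and a common finite set. *)
Definition e_sigma (C : set nat) n (R : seq nat -> Prop) : Prop :=
  exists D : seq nat -> bool, [/\ dec n.+2 D,
    forall s s' u u' v, s <= s' -> canon u `<=` canon u' ->
      D (s :: u :: v) -> D (s' :: u' :: v) &
    forall v, size v = n ->
      (R v <-> exists s u, canon u `<=` C /\ D (s :: u :: v))].

Section ESigma.
Variable C : set nat.

Lemma e_sigma_ext n (R S : seq nat -> Prop) :
  (forall v, size v = n -> (R v <-> S v)) -> e_sigma C n R -> e_sigma C n S.
Proof.
move=> RS [D [dD mD RD]]; exists D; split=> // v sv.
by rewrite -RD // RS.
Qed.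

Lemma canon0_sub (X : set nat) : canon 0 `<=` X.
Proof. by move=> x; rewrite canonE => /canonb_lt. Qed.

Lemma e_sigma_dec n D : dec n D -> e_sigma C n D.
Proof.
move=> dD; exists (fun v => D (behead (behead v))); split=> //.
  exact: (rec_behead (rec_behead dD)).
move=> v _ /=; split=> [Dv|[_ [_ [_ //]]]].
by exists 0, 0; split=> //; exact: canon0_sub.
Qed.

Lemma e_sigma_mem n F : rec n F -> e_sigma C n (fun v => C (F v)).
Proof.
move=> rF; exists (fun v => canonb (head 0 (behead v)) (F (behead (behead v)))); split.
- exact: (dec_canon (rec_behead (rec_head _)) (rec_behead (rec_behead rF))).
- by move=> s s' u u' v _ uu' /=; exact: uu'.
move=> v _ /=; split=> [Cv|[_ [u [uC Fu]]]]; last exact: uC.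
have [u uE] := canon_index (pred1 (F v)) (F v).+1.
exists 0, u; split; last by rewrite uE /= eqxx ltnS leqnn.
by move=> x; rewrite canonE uE => /andP[_ /eqP ->].
Qed.

Lemma e_sigma_ce n W F : ce W -> rec n F -> e_sigma C n (fun v => W (F v)).
Proof.
move=> /ce_stage[D [dD [mD WD]]] rF.
exists (fun v => D [:: head 0 v; F (behead (behead v))]); split.
- exact: (rec_comp2 dD (rec_head _) (rec_behead (rec_behead rF))).
- by move=> s s' u u' v les _ /=; exact: mD.
move=> v _ /=; rewrite WD; split=> [[s Ds]|[s [_ [_ Ds]]]]; last by exists s.
by exists s, 0; split=> //; exact: canon0_sub.
Qed.

Lemma e_sigma_comp n R (Gs : seq (seq nat -> nat)) :
  e_sigma C (size Gs) R ->
  (forall i, i < size Gs -> rec n (nth (fun=> 0) Gs i)) ->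
  e_sigma C n (fun v => R [seq G v | G <- Gs]).
Proof.
move=> [D [dD mD RD]] rGs.
exists (fun v => D (head 0 v :: head 0 (behead v) ::
                    [seq G (behead (behead v)) | G <- Gs])); split.
- have := @rec_comp n.+2 (fun v => D v) (head 0 :: (fun v => head 0 (behead v)) ::
    [seq (fun v => G (behead (behead v))) | G <- Gs]).
  rewrite /= size_map => /(_ dD) H; apply: rec_ext (H _) => [v _|[|[|i]] lti].
  + by rewrite /= -map_comp.
  + exact: rec_head.
  + exact: (rec_behead (rec_head _)).
  + by rewrite /= (nth_map (fun=> 0)) //; exact: (rec_behead (rec_behead (rGs _ lti))).
- by move=> s s' u u' v; exact: mD.
- by move=> v sv; rewrite RD // size_map.
Qed.

Lemma e_sigma_and n R S : e_sigma C n R -> e_sigma C n S ->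
  e_sigma C n (fun v => R v /\ S v).
Proof.
move=> [D [dD mD RD]] [E [dE mE SE]].
exists (fun v => D v && E v); split; first exact: (dec_and dD dE).
  move=> s s' u u' v les leu /andP[Dv Ev].
  by rewrite (mD _ _ _ _ _ les leu Dv) (mE _ _ _ _ _ les leu Ev).
move=> v sv; rewrite RD // SE //; split.
  move=> [[s [u [uC Du]]] [s' [u' [u'C Eu']]]].
  have [w wE] := canon_setU u u'.
  exists (maxn s s'), w; rewrite wE; split; first by rewrite subUset.
  apply/andP; split.
    by apply: mD Du; rewrite ?leq_maxl // wE => x; left.
  by apply: mE Eu'; rewrite ?leq_maxr // wE => x; right.
by move=> [s [u [uC /andP[Du Eu]]]]; split; exists s, u.
Qed.

Lemma e_sigma_exists_ord n m (R : 'I_m -> seq nat -> Prop) :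
  (forall i, e_sigma C n (R i)) -> e_sigma C n (fun v => exists i, R i v).
Proof.
move=> /choice[D HD].
exists (fun v => [exists i, D i v]); split.
- by apply: dec_exists_ord => i; case: (HD i).
- move=> s s' u u' v les leu /existsP[i Di]; apply/existsP; exists i.
  by have [_ mD _] := HD i; exact: mD les leu Di.
move=> v sv; split=> [[i]|[s [u [uC /existsP[i Di]]]]]; have [_ _ RD] := HD i.
  rewrite RD // => -[s [u [uC Du]]]; exists s, u; split=> //.
  by apply/existsP; exists i.
by exists i; apply/RD => //; exists s, u.
Qed.

Lemma e_sigma_or n R S : e_sigma C n R -> e_sigma C n S ->
  e_sigma C n (fun v => R v \/ S v).
Proof.
move=> eR eS.
have := @e_sigma_exists_ord n 2 (fun i => if val i == 0 then R else S).
move=> H; apply: e_sigma_ext (H _) => [v _|i]; last by case: ifP.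
split=> [[i]|[Rv|Sv]]; first by case: ifP => _; [left|right].
  by exists ord0.
by exists ord_max.
Qed.

Lemma rec_rot3 n F : rec n.+3 F ->
  rec n.+3 (fun v => F (head 0 (behead v) :: head 0 (behead (behead v)) ::
                        head 0 v :: behead (behead (behead v)))).
Proof.
move=> rF; have /= := @rec_permute n.+3 F (1 :: 2 :: 0 :: iota 3 n).
rewrite size_iota => /(_ rF) H; apply: rec_ext (H _) => [v sv|].
  rewrite map_nth_iota_drop //.
  by case: v sv => [|? [|? [|? ?]]] //=; rewrite drop0.
by apply/allP => i; rewrite mem_iota => /andP[].
Qed.

(** The stage also bounds the search for the witness, so the matrix stays decidable and monotone. *)
Lemma e_sigma_ex n (R : nat -> seq nat -> Prop) :
  e_sigma C n.+1 (fun v => R (head 0 v) (behead v)) ->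
  e_sigma C n (fun v => exists x, R x v).
Proof.
move=> [D [dD mD RD]].
pose E x v := D (head 0 v :: head 0 (behead v) :: x :: behead (behead v)).
exists (fun v => has (fun x => E x v) (iota 0 (head 0 v))); split.
- exact: (dec_has (D := E) (rec_head _) (rec_rot3 dD)).
- move=> s s' u u' v les leu /hasP[x xs Ex]; apply/hasP; exists x.
    by move: xs; rewrite !mem_iota /=; lia.
  exact: mD les leu Ex.
move=> v sv; split=> [[x Rx]|[s [u [uC /hasP[x _ Ex]]]]].
  have [|s [u [uC Du]]] := (RD (x :: v) _).1 Rx; first by rewrite /= sv.
  exists (maxn s x.+1), u; split=> //; apply/hasP; exists x.
    by rewrite mem_iota /= add0n leq_maxr.
  by apply: mD Du => //; rewrite leq_maxl.
by exists x; apply: (RD (x :: v) _).2; rewrite /= ?sv //; exists s, u.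
Qed.

Lemma e_sigma_all n K (R : nat -> seq nat -> Prop) : rec n K ->
  e_sigma C n.+1 (fun v => R (head 0 v) (behead v)) ->
  e_sigma C n (fun v => forall x, x < K v -> R x v).
Proof.
move=> rK [D [dD mD RD]].
pose E x v := D (head 0 v :: head 0 (behead v) :: x :: behead (behead v)).
exists (fun v => all (fun x => E x v) (iota 0 (K (behead (behead v))))); split.
- exact: (dec_all (D := E) (rec_behead (rec_behead rK)) (rec_rot3 dD)).
- move=> s s' u u' v les leu /allP allE; apply/allP => x xs.
  exact: mD les leu (allE x xs).
move=> v sv; split=> [|[s [u [uC /allP allE]]] x ltx]; last first.
  apply: (RD (x :: v) _).2; rewrite /= ?sv //; exists s, u; split=> //.
  by apply: allE; rewrite mem_iota.
(* Collection by induction on the bound: the stage and finite set found for all [x < k] are merged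
   with those for [k]. *)
rewrite /=; elim: (K v) => [_|k IH Rk].
  by exists 0, 0; split=> //; exact: canon0_sub.
have [x ltx|s [u [uC /allP Du]]] := IH; first by apply: Rk; exact: ltnW.
have [|s' [u' [u'C Du']]] := (RD (k :: v) _).1 (Rk k (ltnSn k)); first by rewrite /= sv.
have [w wE] := canon_setU u u'.
exists (maxn s s'), w; rewrite wE; split; first by rewrite subUset.
apply/allP => x; rewrite mem_iota /= add0n ltnS leq_eqVlt => /orP[/eqP ->|ltx].
  by apply: mD Du'; rewrite ?leq_maxr // wE => y; right.
have /Du Dx : x \in iota 0 k by rewrite mem_iota.
by apply: mD Dx; rewrite ?leq_maxl // wE => y; left.
Qed.

Lemma e_sigma_permute n R (r : seq nat) :
  e_sigma C (size r) R -> all (fun i => i < n) r ->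
  e_sigma C n (fun v => R [seq nth 0 v i | i <- r]).
Proof.
move=> eR /allP lt.
have := @e_sigma_comp n R [seq (fun v => nth 0 v i) | i <- r].
rewrite size_map => /(_ eR) H.
apply: e_sigma_ext (H _) => [v _|i lti]; first by rewrite -map_comp.
by rewrite (nth_map 0) //; apply/rec_nth/lt/mem_nth.
Qed.

Lemma e_sigma_weak1 n (R : nat -> seq nat -> Prop) :
  e_sigma C n.+1 (fun v => R (head 0 v) (behead v)) ->
  e_sigma C n.+2 (fun v => R (head 0 v) (behead (behead v))).
Proof.
move=> eR; have /= := @e_sigma_permute n.+2 _ (0 :: iota 2 n).
rewrite size_iota => /(_ _ eR) H; apply: e_sigma_ext (H _) => [v sv|].
  rewrite map_nth_iota_drop //.
  by case: v sv => [|? [|? ?]] //=; rewrite drop0.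
by apply/allP => i; rewrite mem_iota => /andP[].
Qed.

(** [X] occurs only positively, through the inclusion of a finite set, and this inclusion is a
    universal quantifier bounded by the index [u]. *)
Lemma e_sigma_enum_apply n Theta M (X : nat -> seq nat -> Prop) :
  ce Theta -> rec n M ->
  e_sigma C n.+1 (fun v => X (head 0 v) (behead v)) ->
  e_sigma C n (fun v => enum_apply Theta [set x | X x v] (M v)).
Proof.
move=> ceT rM eX.
pose S u v := (forall x, x < u -> ~~ canonb u x \/ X x v) /\ Theta (pair_code u (M v)).
apply: (@e_sigma_ext n (fun v => exists u, S u v)) => [v _|].
  split=> -[u [uX Tu]]; exists u; split=> //.
    move=> x; rewrite canonE => ux.
    by case: (uX x (canonb_lt ux)) => //; rewrite ux.
  move=> x _; case ux: (canonb u x); [right|by left].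
  exact: uX.
apply: e_sigma_ex; apply: e_sigma_and; last first.
  exact: (e_sigma_ce ceT (rec_pair_code (rec_head _) (rec_behead rM))).
apply: (e_sigma_all (R := fun x v => ~~ canonb (head 0 v) x \/ X x (behead v))).
  exact: rec_head.
apply: e_sigma_or; last exact: e_sigma_weak1.
apply: e_sigma_dec; exact: (dec_neg (dec_canon (rec_behead (rec_head _)) (rec_head _))).
Qed.

Lemma e_sigma_e_le (A : set nat) : e_sigma C 1 (fun v => A (head 0 v)) -> e_le A C.
Proof.
move=> [D [dD _ AD]].
(* [t] bounds the search for an element, an index and a stage; matching [v] against [pair_code u m]
   replaces the decoding of a pair. *)
pose E t v := has (fun m => has (fun u => has (fun s =>
    (v == pair_code u m) && D [:: s; u; m]) (iota 0 t)) (iota 0 t)) (iota 0 t).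
have dE : dec 2 (fun v => E (head 0 v) (head 0 (behead v))).
  apply: (dec_has (D := fun m v => has (fun u => has (fun s =>
    (head 0 (behead v) == pair_code u m) && D [:: s; u; m]) (iota 0 (head 0 v)))
     (iota 0 (head 0 v)))); first exact: rec_head.
  apply: (dec_has (n := 3) (D := fun u v => has (fun s =>
    (head 0 (behead (behead v)) == pair_code u (head 0 v)) && D [:: s; u; head 0 v])
     (iota 0 (head 0 (behead v))))).
    exact: (rec_behead (rec_head _)).
  apply: (dec_has (n := 4) (D := fun s v =>
    (head 0 (behead (behead (behead v))) == pair_code (head 0 v) (head 0 (behead v)))
     && D [:: s; head 0 v; head 0 (behead v)])).
    exact: (rec_behead (rec_behead (rec_head _))).
  have v1 : rec 5 (fun v => head 0 (behead v)) := rec_behead (rec_head _).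
  have v2 : rec 5 (fun v => head 0 (behead (behead v))) :=
    rec_behead (rec_behead (rec_head _)).
  have v4 : rec 5 (fun v => head 0 (behead (behead (behead (behead v))))) :=
    rec_behead (rec_behead (rec_behead (rec_behead (rec_head _)))).
  refine (dec_and (dec_eqn v4 (rec_pair_code v1 v2)) _).
  apply: rec_ext (@rec_permute 5 _ [:: 0; 1; 2] dD isT) => v.
  by case: v => [|? [|? [|? []]]].
have EP c : (exists t, E t c) <-> exists s u m, c = pair_code u m /\ D [:: s; u; m].
  split=> [[t /hasP[m _ /hasP[u _ /hasP[s _ /andP[/eqP -> Ds]]]]]|].
    by exists s, u, m.
  move=> [s [u [m [-> Ds]]]]; exists (maxn s (maxn u m)).+1.
  apply/hasP; exists m; first by rewrite mem_iota /=; lia.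
  apply/hasP; exists u; first by rewrite mem_iota /=; lia.
  apply/hasP; exists s; first by rewrite mem_iota /=; lia.
  by rewrite eqxx.
exists [set c | exists t, E t c]; split; first exact: (ce_of_dec dE).
apply/seteqP; split=> m /=.
  move/(AD [:: m] erefl) => [s [u [uC Du]]]; exists u; split=> //.
  by apply/EP; exists s, u, m.
move=> [u [uC /EP[s [u' [m' [ec Ds]]]]]].
apply/(AD [:: m] erefl); exists s, u; split=> //.
have [-> -> //] : u = u' /\ m = m'.
have := congr1 Cantor.of_nat ec; rewrite !Cantor.cancel_of_to.
by case=> -> ->.
Qed.

End ESigma.

(** * Monotonicity of operators and finite changes of the oracle *)

Lemma enum_apply_mono Theta (X Y : set nat) :
  X `<=` Y -> enum_apply Theta X `<=` enum_apply Theta Y.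
Proof. by move=> XY m [u [uX Tu]]; exists u; split=> //; exact: subset_trans XY. Qed.

Lemma finite_canon (F : set nat) : finite_set F -> exists u, canon u = F.
Proof.
move=> /finite_seqP[s ->]; have [u uE] := canon_index (mem s) (\max_(x <- s) x).+1.
exists u; apply/seteqP; split=> x /=; rewrite canonE uE.
  by move=> /andP[].
move=> xs; apply/andP; split=> //; rewrite ltnS.
exact: leq_bigmax_seq.
Qed.

(** The removed part of [D] is finite with index [w], so the difference is [D] cut down by a
    decidable condition, and the operator can be run from [D]. *)
Lemma e_le_setD_finite (A D E : set nat) :
  finite_set (D `&` E) -> e_le A (D `\` E) -> e_le A D.
Proof.
move=> /finite_canon[w wE] [Theta [ceT ->]].
have -> : D `\` E = [set x | D x /\ ~~ canonb w x].
  apply/seteqP; split=> x /= [Dx].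
    move=> nEx; split=> //; apply/negP; rewrite -canonE wE.
    by case.
  by move=> /negP nw; split=> // Ex; apply: nw; rewrite -canonE wE.
apply: e_sigma_e_le.
apply: (e_sigma_enum_apply (X := fun x _ => D x /\ ~~ canonb w x)) => //.
  exact: rec_head.
apply: e_sigma_and; first exact: e_sigma_mem (rec_head _).
apply: e_sigma_dec; exact: (dec_neg (dec_canon (rec_cst _ _) (rec_head _))).
Qed.

(** * Closed classes of colourings *)

Section Colorings.
Variable k : nat.
Notation coloring := (nat -> 'I_k.+1).

(* U l X stands for a property of the restriction of X to l that persists to
   longer restrictions; it describes the open class of the X with U l X for some l. *)
Definition prefix_mono (U : nat -> coloring -> Prop) : Prop :=
  forall l l' X Y, l <= l' -> (forall x, x < l -> X x = Y x) -> U l X -> U l' Y.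

(** Koenig's lemma for the tree of prefixes: a prefix that has extensions outside [U] at every level
    is prolonged one value at a time. *)
Lemma coloring_compact U : prefix_mono U ->
  (forall l, exists X, ~ U l X) -> exists X, forall l, ~ U l X.
Proof.
move=> mU U0.
pose Ext m (X : coloring) :=
  forall l, exists Y, (forall x, x < m -> X x = Y x) /\ ~ U l Y.
have step m X : Ext m X -> exists X' : coloring,
    (forall x, x < m -> X x = X' x) /\ Ext m.+1 X'.
  move=> eX; apply: contrapT => /forallNP nX.
  pose Xc c x := if x == m then c else X x.
  (* If every colour [c] at position [m] fails, it does so by some level [L c]; at the largest of
     these levels [U] holds of all extensions of the prefix, against [Ext m X]. *)
  have /choice[L HL] : forall c, exists l, forall Y : coloring,
      (forall x, x < m.+1 -> Xc c x = Y x) -> U l Y.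
    move=> c; apply: contrapT => /forallNP nL; apply: (nX (Xc c)); split.
      by move=> x ltx; rewrite /Xc ltn_eqF.
    move=> l; have /existsNP[Y /not_implyP[agr nU]] := nL l.
    by exists Y.
  have [Y [agr nU]] := eX (\max_c L c).
  apply: nU; apply: (mU (L (Y m)) _ Y) => //; first exact: leq_bigmax.
  apply: HL => x; rewrite ltnS leq_eqVlt /Xc => /orP[/eqP ->|ltx].
    by rewrite eqxx.
  by rewrite ltn_eqF // agr.
have /choice[nxt Hnxt] : forall mX : nat * coloring, exists X' : coloring,
    Ext mX.1 mX.2 -> (forall x, x < mX.1 -> mX.2 x = X' x) /\ Ext mX.1.+1 X'.
  move=> [m X] /=; have [/step[X' HX']|nE] := pselect (Ext m X); first by exists X'.
  by exists X.
pose Z := fix Z m : coloring := if m is m'.+1 then nxt (m', Z m') else fun=> ord0.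
have EZ m : Ext m (Z m).
  elim: m => [l|m IH]; first by have [X nU] := U0 l; exists X.
  exact: (Hnxt (m, Z m) IH).2.
have ZZ m d x : x < m -> Z m x = Z (m + d) x.
  move=> ltx; elim: d => [|d ->]; first by rewrite addn0.
  rewrite addnS; apply: (Hnxt (m + d, Z (m + d)) (EZ _)).1 => /=.
  exact: ltn_addr.
(* The value at [x] is settled from [Z x.+1] on, so the limit agrees with [Z l] below [l]. *)
exists (fun x => Z x.+1 x) => l Ul.
have [Y [agr nU]] := EZ l l; apply: nU; apply: mU Ul => // x ltx.
by rewrite -agr // (ZZ x.+1 (l - x.+1)) // subnKC.
Qed.

Definition decode (p : nat) : coloring := fun x => inord ((p %/ k.+1 ^ x) %% k.+1).

Lemma decode_surj (X : coloring) l :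
  exists2 p, p < k.+1 ^ l & forall x, x < l -> decode p x = X x.
Proof.
have [//|p ltp pX] := @digits_exist k.+1 (fun x => X x) l.
by exists p => // x ltx; rewrite /decode pX ltx inord_val.
Qed.

Lemma dec_decode n P F (i : 'I_k.+1) :
  rec n P -> rec n F -> dec n (fun v => decode (P v) (F v) == i).
Proof.
move=> rP rF.
have r := rec_mod (rec_div rP (rec_exp (rec_cst n k.+1) rF)) (rec_cst n k.+1).
apply: rec_ext (dec_eqn r (rec_cst n i)) => v _.
by rewrite /decode -val_eqE /= inordK // ltn_pmod.
Qed.

Variable C : set nat.

(** By monotonicity [U m l X] depends only on [X] below [l], so the quantifier over all colourings
    becomes a bounded one over codes. *)
Lemma e_sigma_covered (U : nat -> nat -> coloring -> Prop) :
  (forall m, prefix_mono (U m)) ->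
  e_sigma C 3 (fun v => U (head 0 (behead (behead v))) (head 0 (behead v))
                          (decode (head 0 v))) ->
  e_sigma C 1 (fun v => exists l, forall X, U (head 0 v) l X).
Proof.
move=> mU eU.
apply: (@e_sigma_ext _ _ (fun v => exists l, forall p, p < k.+1 ^ l ->
    U (head 0 v) l (decode p))) => [v _|].
  split=> -[l Ul]; exists l => // X.
  have [p ltp pX] := decode_surj X l.
  exact: mU (leqnn l) pX (Ul p ltp).
apply: e_sigma_ex.
apply: (e_sigma_all (n := 2) (K := fun v => k.+1 ^ head 0 v)
  (R := fun p v => U (head 0 (behead v)) (head 0 v) (decode p))) => //.
exact: (rec_exp (rec_cst _ _) (rec_head _)).
Qed.

Definition restr (X : coloring) i l : set nat := [set x | [/\ x < l, X x = i & C x]].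

Definition forced Theta i m l X : Prop := enum_apply Theta (restr X i l) m.

Lemma forced_mono Theta i m : prefix_mono (forced Theta i m).
Proof.
move=> l l' X Y lel XY; apply: enum_apply_mono => x [ltx Xx Cx].
by split=> //; [exact: leq_trans lel | rewrite -XY].
Qed.

Lemma forcedP Theta i m X :
  enum_apply Theta [set x | X x = i /\ C x] m <-> exists l, forced Theta i m l X.
Proof.
split=> [[u [uX Tu]]|[l]]; last by apply: enum_apply_mono => x [].
(* The elements of the finite set used lie below its index, which therefore serves as the prefix
   length. *)
exists u, u; split=> // x ux; have [Xx Cx] := uX x ux.
by split=> //; exact: canonb_lt.
Qed.

Lemma e_sigma_forced n Theta i M L P :
  ce Theta -> rec n M -> rec n L -> rec n P ->
  e_sigma C n (fun v => forced Theta i (M v) (L v) (decode (P v))).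
Proof.
move=> ceT rM rL rP.
apply: (e_sigma_enum_apply (X := fun x v => restr (decode (P v)) i (L v) x)) => //.
apply: (@e_sigma_ext _ _ (fun v => ((head 0 v < L (behead v)) &&
   (decode (P (behead v)) (head 0 v) == i)) /\ C (head 0 v))).
  move=> v _; split=> [[/andP[lt /eqP di Cv]]|[lt di Cv]]; split=> //.
  by rewrite lt di eqxx.
apply: e_sigma_and; last exact: e_sigma_mem (rec_head _).
apply: e_sigma_dec.
exact: (dec_and (dec_ltn (rec_head _) (rec_behead rL))
  (dec_decode i (rec_behead rP) (rec_head _))).
Qed.

(* The forcing condition is the class of the X avoiding Q; the last clause says
   that it is nonempty, by compactness. *)
Definition open_cond (Q : nat -> coloring -> Prop) : Prop :=
  [/\ prefix_mono Q,
      e_sigma C 2 (fun v => Q (head 0 (behead v)) (decode (head 0 v))) &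
      forall l, exists X, ~ Q l X].

Lemma open_cond_or Q U : open_cond Q -> prefix_mono U ->
  e_sigma C 2 (fun v => U (head 0 (behead v)) (decode (head 0 v))) ->
  (forall l, exists X, ~ (Q l X \/ U l X)) ->
  open_cond (fun l X => Q l X \/ U l X).
Proof.
move=> [mQ eQ _] mU eU ne; split=> //; last exact: e_sigma_or.
by move=> l l' X Y lel XY [/(mQ _ _ _ _ lel XY)|/(mU _ _ _ _ lel XY)]; [left|right].
Qed.

Lemma open_cond_force (A : set nat) Q Psi i :
  ~ e_le A C -> open_cond Q -> ce Psi ->
  exists Q', [/\ open_cond Q', forall l X, Q l X -> Q' l X &
    forall X, (forall l, ~ Q' l X) -> enum_apply Psi [set x | X x = i /\ C x] <> A].
Proof.
move=> nAC cQ ceP; have [mQ eQ neQ] := cQ.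
have v1 n : rec n.+2 (fun v => head 0 (behead v)) := rec_behead (rec_head _).
(* First case: some [m] in [A] can be kept out of the image of the colour class for ever, by
   avoiding [forced] as well. *)
have [[m [Am ne]]|nout] := pselect (exists m, A m /\
    forall l, exists X, ~ (Q l X \/ forced Psi i m l X)).
  exists (fun l X => Q l X \/ forced Psi i m l X); split.
  - apply: open_cond_or => //; first exact: forced_mono.
    exact: (e_sigma_forced i ceP (rec_cst _ m) (v1 _) (rec_head _)).
  - by left.
  - move=> X nX eA; move: Am; rewrite -eA => /forcedP[l fl].
    by apply: (nX l); right.
(* Second case: some [X0] in the class puts an [m] outside [A] into the image, using only its values
   below [l0]. *)
have [[m [nAm [X0 [l0 [fX0 nQX0]]]]]|nin] := pselect (exists m, ~ A m /\
    exists X0 l0, forced Psi i m l0 X0 /\ forall l, ~ Q l X0).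
  (* The complement of the cylinder of [X0] at [l0]; the guard [x < l] makes it a property of the
     prefix. *)
  pose U l (X : coloring) := exists x : 'I_l0, (x < l) && (X x != X0 x).
  exists (fun l X => Q l X \/ U l X); split.
  - apply: open_cond_or => //.
    + move=> l l' X Y lel XY [x /andP[ltx Xx]]; exists x.
      by rewrite (leq_trans ltx lel) -XY.
    + apply: e_sigma_exists_ord => x; apply: e_sigma_dec.
      exact: (dec_and (dec_ltn (rec_cst _ x) (v1 _))
        (dec_neg (dec_decode (X0 x) (rec_head _) (rec_cst _ x)))).
    + move=> l; exists X0 => -[|[x]]; first exact: nQX0.
      by rewrite eqxx andbF.
  - by left.
  - move=> X nX eA; apply: nAm; rewrite -eA; apply/forcedP; exists l0.
    apply: forced_mono fX0 => // x ltx; apply/esym/eqP/negPn/negP => neqx.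
    by apply: (nX l0); right; exists (Ordinal ltx); rewrite ltx.
(* Otherwise [A] consists of the [m] for which, at some level, every colouring is in [Q] or forces
   [m]; this is enumerated from [C]. *)
case: nAC; apply: e_sigma_e_le.
apply: (@e_sigma_ext _ _ (fun v => exists l, forall X,
    Q l X \/ forced Psi i (head 0 v) l X)); last first.
  apply: (e_sigma_covered (U := fun m l X => Q l X \/ forced Psi i m l X)).
    move=> m l l' X Y lel XY [/(mQ _ _ _ _ lel XY)|]; first by left.
    by move/(forced_mono lel XY); right.
  apply: e_sigma_or.
    apply: e_sigma_ext (@e_sigma_permute C 3 _ [:: 0; 1] eQ isT) => v.
    by case: v => [|? [|? ?]].
  exact: (e_sigma_forced i ceP (rec_behead (v1 _)) (v1 _) (rec_head _)).
(* For a covered [m], a colouring avoiding [Q] throughout forces [m], so [m] is in [A] by failure of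
   the second case. An uncovered [m] in [A] would give the first case. *)
move=> [//|m [|//]] _ /=; split=> [[l covl]|Am].
  apply: contrapT => nAm; have [X nQX] := coloring_compact mQ neQ.
  apply: nin; exists m; split=> //; exists X, l; split=> //.
  by case: (covl X) => // /nQX.
apply: contrapT => /forallNP ncov; apply: nout; exists m; split=> // l.
exact/existsNP.
Qed.

(** The condition chosen at stage [pickle (e, i)] prevents [W e] from reducing [A] to the class of
    colour [i]; compactness yields one colouring that avoids all the increasing open classes. *)
Lemma open_cond_generic (A : set nat) Q0 :
  ~ e_le A C -> open_cond Q0 ->
  exists X : coloring, (forall l, ~ Q0 l X) /\
    forall i, ~ e_le A [set x | X x = i /\ C x].
Proof.
move=> nAC cQ0; have [W [ceW Wall]] := ce_enumeration.
have /choice[nxt Hnxt] : forall eQ : (nat * 'I_k.+1) * (nat -> coloring -> Prop),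
    exists Q', open_cond eQ.2 -> [/\ open_cond Q', forall l X, eQ.2 l X -> Q' l X &
    forall X, (forall l, ~ Q' l X) ->
      enum_apply (W eQ.1.1) [set x | X x = eQ.1.2 /\ C x] <> A].
  move=> [[e i] Q] /=; have [cQ|ncQ] := pselect (open_cond Q); last by exists Q.
  by have [Q' HQ'] := open_cond_force i nAC cQ (ceW e); exists Q'.
pose task s : nat * 'I_k.+1 := odflt (0, ord0) (unpickle s).
pose Q := fix Q s := if s is s'.+1 then nxt (task s', Q s') else Q0.
have cQ s : open_cond (Q s).
  by elim: s => [|s IH] //; have [] := Hnxt (task s, Q s) IH.
have mQ s l X : Q s l X -> Q s.+1 l X.
  by have [_ + _] := Hnxt (task s, Q s) (cQ s); apply.
have mQs s s' l X : s <= s' -> Q s l X -> Q s' l X.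
  by move=> /subnKC <- H; elim: (s' - s) => [|d IH]; rewrite ?addn0 ?addnS //; exact: mQ.
(* Avoiding the diagonal class is avoiding all the Q s, as they increase with s. *)
have [l|l|X nX] := @coloring_compact (fun l X => Q l l X).
- move=> l' X Y lel XY /(mQs _ _ _ _ lel); have [m _ _] := cQ l'.
  exact: m lel XY.
- by have [_ _] := cQ l; apply.
have nQ s l : ~ Q s l X.
  have [les|les] := leqP s l; first by move/(mQs _ _ _ _ les); exact: nX.
  move=> QX; apply: (nX s); have [m _ _] := cQ s.
  by apply: m QX => //; exact: ltnW.
exists X; split; first exact: (nQ 0).
move=> i [Psi [/Wall[e <-] eA]].
have [_ _ +] := Hnxt (task (pickle (e, i)), Q _) (cQ (pickle (e, i))).
rewrite /task pickleK /= => /(_ X) H; apply: H (esym eA) => l.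
have := nQ (pickle (e, i)).+1 l.
by rewrite /= /task pickleK.
Qed.

End Colorings.

(** * Induction on the number of sets *)

Lemma i_e_le_bigcup k (A : set nat) (B : 'I_k -> set nat) :
  (forall i, infinite_set (B i)) -> (forall i, ui_e_le A (B i)) ->
  i_e_le A (\bigcup_(i in [set: 'I_k]) B i).
Proof.
elim: k B => [|k IH] B Binf AB C Cinf CB.
  (* The induction starts at the empty union, which has no infinite subset. *)
  case: Cinf; suff -> : C = set0 by [].
  by apply/seteqP; split=> // x /CB [[]].
apply: contrapT => nAC.
have /choice[Theta HT] := AB.
have ceT i : ce (Theta i) := (HT i).1.
pose Bad a l X := exists i, forced C (Theta i) i a l X.
have mBad a : prefix_mono (Bad a).
  by move=> l l' X Y lel XY [i /(forced_mono lel XY)]; exists i.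
have v1 n : rec n.+2 (fun v => head 0 (behead v)) := rec_behead (rec_head _).
have [[a [Aa ne]]|cov] := pselect (exists a, A a /\ forall l, exists X, ~ Bad a l X).
  have cBad : open_cond C (Bad a).
    split=> //; apply: e_sigma_exists_ord => i.
    exact: (e_sigma_forced C i (ceT i) (rec_cst _ a) (v1 _) (rec_head _)).
  have [X [nBad nA]] := open_cond_generic nAC cBad.
  have [i iinf] : exists i, infinite_set [set x | X x = i /\ C x].
    apply: contrapT => /forallNP fin; apply: Cinf.
    apply: (@sub_finite_set _ _ (\bigcup_(i in [set: 'I_k.+1]) [set x | X x = i /\ C x])).
      by move=> x Cx; exists (X x).
    apply: bigcup_finite => [|i _]; last exact: (contrapT (fin i)).
    exact: finite_finset.
  set D := [set x | _] in iinf.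
  (* An infinite intersection would be mapped onto [A] by [Theta i]; by monotonicity [a] would be in
     the image of [D], making [X] bad. *)
  have finDB : finite_set (D `&` B i).
    apply: contrapT => DBinf; have := (HT i).2 _ DBinf (@subIsetr _ _ _).
    move=> eA; move: Aa; rewrite -eA => /(enum_apply_mono (@subIsetl _ D (B i))).
    by move=> /forcedP[l fl]; apply: (nBad l); exists i.
  (* Removing [B i] costs finitely many elements; the infinite rest is covered by the other sets,
     reindexed by [lift i]. *)
  apply: (nA i); apply: (e_le_setD_finite finDB).
  apply: (IH (fun j => B (lift i j))) => //.
    by move=> finD; apply: iinf; rewrite -(setUIDK D (B i)) finite_setU.
  move=> x [[_ Cx] nBx]; have [j _ Bjx] := CB x Cx.
  case: (unliftP i j) => [j' jE|jE]; last by case: nBx; rewrite -jE.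
  by exists j' => //; rewrite -jE.
(* Now every [a] in [A] has a level at which all colourings are bad; it remains to see that only
   elements of [A] do. *)
apply: nAC; apply: e_sigma_e_le.
apply: (@e_sigma_ext _ _ (fun v => exists l, forall X, Bad (head 0 v) l X)); last first.
  apply: e_sigma_covered => //; apply: e_sigma_exists_ord => i.
  exact: (e_sigma_forced C i (ceT i) (rec_behead (v1 _)) (v1 _) (rec_head _)).
move=> [//|a [|//]] _ /=; split=> [[l covl]|Aa]; last first.
  apply: contrapT => /forallNP ncov; apply: cov; exists a; split=> // l.
  exact/existsNP.
(* Colouring by membership puts each class inside its [B i], whose image is [A]; the default [ord0]
   is used only off [C], which [restr] discards. *)
have /choice[X XB] : forall x, exists i, C x -> B i x.
  move=> x; have [Cx|nCx] := pselect (C x); last by exists ord0.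
  by have [i _ Bi] := CB x Cx; exists i.
have [i fi] := covl X.
rewrite -((HT i).2 (B i) (Binf i) (@subset_refl _ _)).
apply: enum_apply_mono fi => x [_ <- Cx].
exact: XB.
Qed.

Theorem theorem4p11 (n : nat) (A : set nat) (B : 'I_n.+1 -> set nat)
  (Ainf : infinite_set A) (Binf : forall i : 'I_n.+1, infinite_set (B i))
  (AB : forall i : 'I_n.+1, ui_e_le A (B i)) :
  i_e_le A (\bigcup_(i in [set: 'I_n.+1]) B i).
Proof. exact: i_e_le_bigcup. Qed.
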